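(* Let $H$ be a real pre-Hilbert space, let $d\in\mathbb{N}$, $d\ge 1$, and assume $\dim(H)\ge d+1$ (possibly infinite). Then the functions $(v_1,\dots,v_{d+1})\mapsto |\mathrm{p}_d\mathrm{sin}_0(v_1,\dots,v_{d+1})|$ and $(v_1,\dots,v_{d+1})\mapsto |\mathrm{g}_d\mathrm{sin}_0(v_1,\dots,v_{d+1})|$ are $d$-semimetrics with respect to the set $H\setminus\{0\}$.
   Context: Absolute content: for vectors $v_1,\dots,v_k\in H$, $|M_k(v_1,\dots,v_k)|=\left[\det\left(\{\langle v_i,v_j\rangle\}_{i,j=1}^k\right)\right]^{1/2}$. Polar sine: $|\mathrm{p}_d\mathrm{sin}_0(v_1,\dots,v_{d+1})|=\dfrac{|M_{d+1}(v_1,\dots,v_{d+1})|}{\prod_{j=1}^{d+1}\|v_j\|}$, with value $0$ if the denominator is $0$. $d$-th root of the hypersine: $|\mathrm{g}_d\mathrm{sin}_0(v_1,\dots,v_{d+1})|=\dfrac{|M_{d+1}(v_1,\dots,v_{d+1})|}{\left(\prod_{j=1}^{d+1}|M_d(v_1,\dots,v_{j-1},v_{j+1},\dots,v_{d+1})|\right)^{1/d}}$, with value $0$ if the denominator is $0$. $d$-semimetric: given a set $E$, a function $f:E^{d+1}\to[0,\infty)$ is a $d$-semimetric with respect to $E$ if it is symmetric (invariant under permutations of its arguments) and satisfies $$f(x_1,\dots,x_{d+1})\le\sum_{i=1}^{d+1}f(x_1,\dots,x_{i-1},u,x_{i+1},\dots,x_{d+1})\quad\text{for all }x_1,\dots,x_{d+1},u\in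 E.$$ *)

(* Defs.v *)
From mathcomp Require Import all_boot all_order all_fingroup all_algebra.
From mathcomp Require Import classical_sets reals exp.

Set Implicit Arguments.
Unset Strict Implicit.
Unset Printing Implicit Defensive.

Import Order.TTheory GRing.Theory Num.Theory.

Local Open Scope classical_set_scope.
Local Open Scope ring_scope.

(* A real pre-Hilbert space is an lmodType over a realType together with a
   positive definite symmetric bilinear form; [{dot H for idfun}] is MathComp's
   type of such forms. *)
Section PreHilbert.
Context {R : realType} {H : lmodType R}.

Definition linearly_independent (n : nat) (e : 'I_n -> H) : Prop :=
  forall c : 'I_n -> R, \sum_(i < n) c i *: e i = 0 -> forall i, c i = 0.

Variable ip : {dot H for @idfun R}.

Definition ip_norm (v : H) : R := Num.sqrt (ip v v).

Definition abs_content (k : nat) (v : 'I_k -> H) : R :=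
  Num.sqrt (\det (\matrix_(i < k, j < k) ip (v i) (v j))).

Definition abs_psin0 (d : nat) (v : 'I_d.+1 -> H) : R :=
  let D := \prod_(j < d.+1) ip_norm (v j) in
  if D == 0 then 0 else abs_content v / D.

(* [v \o lift j] is the family [v] with its [j]-th vector omitted; for d >= 1,
   [x `^ d%:R^-1] is the [d]-th root of x >= 0, in particular 0 at x = 0. *)
Definition abs_gsin0 (d : nat) (v : 'I_d.+1 -> H) : R :=
  let D := (\prod_(j < d.+1) abs_content (v \o lift j)) `^ d%:R^-1 in
  if D == 0 then 0 else abs_content v / D.

End PreHilbert.

(* dim H >= n, where dim H may be infinite. *)
Definition dim_ge {R : realType} (H : lmodType R) (n : nat) : Prop :=
  exists e : 'I_n -> H, linearly_independent e.

(* [f] is defined on all families of [T]; the function E^(d+1) -> [0, oo) is its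
   restriction to families of elements of [E]. *)
Definition semimetric {R : realType} {T : Type} (d : nat) (E : set T)
    (f : ('I_d.+1 -> T) -> R) : Prop :=
  [/\ forall x, (forall i, E (x i)) -> 0 <= f x,
      forall (s : 'S_d.+1) x, (forall i, E (x i)) -> f (x \o s) = f x
    & forall x u, (forall i, E (x i)) -> E u ->
        f x <= \sum_(i < d.+1) f (fun j => if j == i then u else x j)].

(* Main.v *)
(** By Gram-Schmidt, |M(x, W)| is |M(W)| times the distance of x to span W.
    Write u = \sum_i c_i v_i + q with q orthogonal to all v_i, M for the content
    of v and M_i for the content of v with v_i replaced by u. Taking residuals
    modulo the other vectors gives M |c_i v_i + q| <= M_i |v_i|, so the triangle
    inequality yields M |u| <= \sum_i M_i |v_i|, which is the simplex inequality
    for the polar sine.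

    For the other function, let m_i be the content of v without v_i and n_ij that
    of v without v_i and v_j but with u. The case of two vectors of the previous
    inequality, applied to residuals modulo the remaining ones, gives
    M n_ij <= M_i m_j + M_j m_i <= m_i m_j S with S = \sum_i M_i / m_i. Hence the
    denominator (m_i \prod_(j != i) n_ij)^(1/d) of the i-th term is at most
    (m_i S / M) (\prod_j m_j)^(1/d), and summing the terms concludes. *)
Require Import Defs.
From mathcomp Require Import all_boot all_order all_fingroup all_algebra.
From mathcomp Require Import classical_sets reals exp.
From mathcomp Require Import ring lra.

Set Implicit Arguments.
Unset Strict Implicit.
Unset Printing Implicit Defensive.

Import Order.TTheory GRing.Theory Num.Theory.

Local Open Scope classical_set_scope.
Local Open Scope ring_scope.

Section PreHilbertTheory.
Context {R : realType} {H : lmodType R}.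
Variable ip : {dot H for @idfun R}.
Implicit Types (x y u w q : H) (s t W : seq H) (a : R).

Local Notation norm := (ip_norm ip).

(** * Inner product and norm: Cauchy-Schwarz and the triangle inequality *)

Lemma ipC x y : ip x y = ip y x.
Proof. by rewrite hermC /= expr0 mul1r. Qed.

Lemma ip_ge0 x : 0 <= ip x x.
Proof.
have [->|x0] := eqVneq x 0; first by rewrite linear0l.
exact/ltW/neq0_dnorm_gt0.
Qed.

Lemma ip_eq0 x : (ip x x == 0) = (x == 0).
Proof.
have [->|x0] := eqVneq x 0; first by rewrite linear0l eqxx.
exact/gt_eqF/neq0_dnorm_gt0.
Qed.

Lemma ip_norm_ge0 x : 0 <= norm x.
Proof. exact: sqrtr_ge0. Qed.

Lemma ip_norm_sqr x : norm x ^+ 2 = ip x x.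
Proof. by rewrite sqr_sqrtr // ip_ge0. Qed.

Lemma ip_norm_gt0 x : (0 < norm x) = (x != 0).
Proof. by rewrite sqrtr_gt0 lt_def ip_eq0 ip_ge0 andbT. Qed.

Lemma ip_norm0 : norm 0 = 0.
Proof. by rewrite /ip_norm linear0l sqrtr0. Qed.

Lemma ipDl x y u : ip (x + y) u = ip x u + ip y u. Proof. exact: linearDl. Qed.
Lemma ipDr x y u : ip u (x + y) = ip u x + ip u y. Proof. exact: linearDr. Qed.
Lemma ipZl a x u : ip (a *: x) u = a * ip x u. Proof. exact: linearZl_LR. Qed.
Lemma ipZr a x u : ip u (a *: x) = a * ip u x. Proof. exact: linearZr_LR. Qed.

Lemma ip_suml n (F : 'I_n -> H) u : ip (\sum_i F i) u = \sum_i ip (F i) u.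
Proof. exact: (big_morph (ip^~ u) (fun x y => ipDl x y u) (linear0l ip u)). Qed.

Lemma Cauchy_Schwarz x y : ip x y <= norm x * norm y.
Proof.
have [->|y0] := eqVneq y 0; first by rewrite ip_norm0 linear0r mulr0.
have yy : 0 < norm y ^+ 2 by rewrite exprn_gt0 // ip_norm_gt0.
(* Scaling [x] by [norm y ^+ 2] avoids a division: the square expands to
   [|y|^2 (|x|^2 |y|^2 - (ip x y)^2)]. *)
have := ip_ge0 (norm y ^+ 2 *: x + (- ip x y) *: y).
rewrite !(ipDl, ipDr, ipZl, ipZr) (ipC y x) -!ip_norm_sqr.
move: (ip x y) (norm x) (norm y) yy (ip_norm_ge0 x) (ip_norm_ge0 y).
move=> c p q qq p0 q0 h.
suff : c ^+ 2 <= (p * q) ^+ 2.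
  move=> h2; apply: le_trans (ler_norm c) _.
  by rewrite -(@ler_pXn2r _ 2) // ?nnegrE ?mulr_ge0 // real_normK // num_real.
rewrite -subr_ge0 -(pmulr_rge0 _ qq); apply: le_trans h _.
rewrite le_eqVlt; apply/orP; left; apply/eqP; ring.
Qed.

Lemma ler_ip_normD x y : norm (x + y) <= norm x + norm y.
Proof.
rewrite -(@ler_pXn2r _ 2) // ?nnegrE ?addr_ge0 ?ip_norm_ge0 //.
rewrite ip_norm_sqr ipDl !ipDr sqrrD !ip_norm_sqr (ipC y x).
have := Cauchy_Schwarz x y; lra.
Qed.

Lemma ler_ip_norm_sum n (F : 'I_n -> H) :
  norm (\sum_i F i) <= \sum_i norm (F i).
Proof.
elim/big_ind2: _ => [|x1 x2 y1 y2 h1 h2|//]; first by rewrite ip_norm0.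
by apply: le_trans (ler_ip_normD _ _) _; apply: lerD.
Qed.

(** * Gram-Schmidt: [resid s] is the orthogonal projection along the span of [s] *)

(* Junk value: if [w'] is 0 the coefficient of [w'] is [_ / 0] = 0, so [s] need not
   be linearly independent. *)
Fixpoint resid s x : H :=
  if s is w :: s' then
    let w' := resid s' w in
    let x' := resid s' x in x' - (ip x' w' / ip w' w') *: w'
  else x.

Lemma residP s a x y : resid s (a *: x + y) = a *: resid s x + resid s y.
Proof.
elim: s x y => //= w s IH x y; rewrite IH ipDl ipZl mulrDl scalerDl -mulrA -scalerA.
by rewrite opprD scalerBr addrACA.
Qed.

Lemma resid0 s : resid s 0 = 0.
Proof. by have := residP s (-1) 0 0; rewrite !scaleN1r oppr0 addr0 addNr. Qed.

Lemma residD s x y : resid s (x + y) = resid s x + resid s y.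
Proof. by have := residP s 1 x y; rewrite !scale1r. Qed.

Lemma residZ s a x : resid s (a *: x) = a *: resid s x.
Proof. by have := residP s a x 0; rewrite resid0 !addr0. Qed.

Lemma resid_sum s n (F : 'I_n -> H) :
  resid s (\sum_i F i) = \sum_i resid s (F i).
Proof. exact: (big_morph _ (residD s) (resid0 s)). Qed.

Lemma resid_id s x : resid s (resid s x) = resid s x.
Proof.
elim: s x => //= w s IH x.
set w' := resid s w; set x' := resid s x; set c := ip x' w' / _.
rewrite -!scaleNr residD residZ !IH -/x' -/w' ipDl ipZl.
have [->|w0] := eqVneq w' 0; first by rewrite !scaler0 !addr0.
suff -> : ip x' w' + - c * ip w' w' = 0 by rewrite mul0r oppr0 scale0r addr0.
by rewrite mulNr divfK ?ip_eq0 // subrr.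
Qed.

(** By induction and idempotence, [ip (resid s x) w' = ip x w'], so the term subtracted at each
    stage is symmetric in [x] and [y]. With [resid_id], this makes [resid s] an orthogonal
    projection. *)
Lemma resid_adj s x y : ip (resid s x) y = ip x (resid s y).
Proof.
elim: s x y => //= w s IH x y; rewrite -!scaleNr ipDl ipDr ipZl ipZr IH.
rewrite [ip (resid s x) _]IH resid_id [ip (resid s y) _]IH resid_id IH.
by rewrite [ip y _]ipC IH; ring.
Qed.

Lemma resid_mem s w : w \in s -> resid s w = 0.
Proof.
elim: s => //= y s IH; rewrite inE => /predU1P[->|/IH->]; last first.
  by rewrite linear0l mul0r scale0r subr0.
have [->|w0] := eqVneq (resid s y) 0; first by rewrite scaler0 subr0.
by rewrite divff ?ip_eq0 // scale1r subrr.
Qed.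

Lemma resid_orth s x w : w \in s -> ip (resid s x) w = 0.
Proof. by move=> ws; rewrite resid_adj resid_mem // linear0r. Qed.

Lemma resid_fix s q : (forall w, w \in s -> ip q w = 0) -> resid s q = q.
Proof.
elim: s => //= w s IH qs.
have qE : resid s q = q by apply: IH => y ys; apply: qs; rewrite inE ys orbT.
by rewrite qE -resid_adj qE qs ?mem_head // mul0r scale0r subr0.
Qed.

Lemma resid_span s x :
  exists c : nat -> R, x = resid s x + \sum_(k < size s) c k *: s`_k.
Proof.
elim: s x => [|w s IH] x; first by exists (fun=> 0); rewrite big_ord0 addr0.
have [c xE] := IH x; have [d wE] := IH w; rewrite /=.
set a := (_ / _).
(* Coefficients obtained by replacing [resid s w] with [w] minus its part in the span of [s]: the
   head gets [a], and the others are corrected by [a * d]. *)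
exists (fun k => if k is k'.+1 then c k' - a * d k' else a).
rewrite big_ord_recl /=.
under eq_bigr => k _ do rewrite scalerBl -scalerA.
rewrite sumrB -scaler_sumr {1}xE {2}wE scalerDr.
by rewrite -[in RHS]addrA -(addrA (a *: _)) addKr [in RHS](addrC (a *: _)) subrK.
Qed.

(** * Gram determinants and contents of sequences *)

Definition gram s : R :=
  \det (\matrix_(i < size s, j < size s) ip s`_i s`_j).

Lemma gram_size n s : size s = n ->
  gram s = \det (\matrix_(i < n, j < n) ip s`_i s`_j).
Proof. by move=> <-. Qed.

(** Rows and columns undergo the same permutation, so its sign occurs twice and cancels. *)
Lemma perm_gram s t : perm_eq s t -> gram s = gram t.
Proof.
move=> st; have /tuple_permP[p sE] : perm_eq s (in_tuple t) by [].
have p_ s0 (i : 'I_(size t)) : s`_i = t`_(p i).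
  by rewrite sE -tnth_nth tnth_mktuple (tnth_nth 0).
rewrite (@gram_size (size t)) ?(perm_size st) // /gram.
set A := (X in _ = \det X).
suff -> : \matrix_(i < size t, j < size t) ip s`_i s`_j = row_perm p (col_perm p A).
  rewrite row_permE col_permE !det_mulmx !det_perm mulrCA -signr_addb.
  by rewrite odd_permV addbb mulr1.
by apply/matrixP => i j; rewrite !mxE !p_.
Qed.

(** Subtracting from the row of [x] the combination of the other rows given by [resid_span] leaves
    [ip q q] followed by zeros, since [q] is orthogonal to [s]. *)
Lemma gram_cons x s : gram (x :: s) = ip (resid s x) (resid s x) * gram s.
Proof.
have [c xE] := resid_span s x.
set q := resid s x in xE *.
pose n := size s.
pose al : 'rV[R]_n := \row_k c k.
pose G : 'M[R]_n := \matrix_(i, j) ip s`_i s`_j.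
pose b : 'cV[R]_n := \col_k ip s`_k x.
have ipx y : ip x y = ip q y + \sum_(k < n) al 0 k * ip s`_k y.
  rewrite {1}xE ipDl ip_suml; congr (_ + _).
  by apply: eq_bigr => k _; rewrite ipZl mxE.
have gE : gram (x :: s) = \det (block_mx (ip x x)%:M (al *m G) b G).
  rewrite /gram /=; congr (\det _); apply/matrixP => i j.
  rewrite mxE -(@splitK 1 n i) -(@splitK 1 n j).
  case: (@split 1 n i) => i'; case: (@split 1 n j) => j' /=.
  - by rewrite [RHS](@block_mxEul _ 1 n 1 n) !ord1 !mxE eqxx mulr1n.
  - rewrite [RHS](@block_mxEur _ 1 n 1 n) !ord1 !mxE /= ipx.
    rewrite (resid_orth _ (mem_nth 0 (ltn_ord j'))) add0r.
    by apply: eq_bigr => k _; rewrite !mxE.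
  - by rewrite [RHS](@block_mxEdl _ 1 n 1 n) !ord1 !mxE.
  - by rewrite [RHS](@block_mxEdr _ 1 n 1 n) !mxE.
rewrite gE.
(* The row operation as a factorization: a unipotent block matrix times a block lower triangular
   one. *)
have -> : block_mx (ip x x)%:M (al *m G) b G =
  block_mx 1%:M al 0 1%:M *m block_mx (ip q q)%:M 0 b G.
  rewrite mulmx_block !mul1mx !mul0mx !add0r; congr block_mx.
  apply/matrixP => i j; rewrite !ord1 !mxE eqxx !mulr1n [LHS]ipx.
  rewrite ipC /q resid_adj resid_id; congr (_ + _); apply: eq_bigr => k _.
  by rewrite !mxE.
by rewrite det_mulmx det_ublock det_lblock !det1 !mul1r det_scalar1.
Qed.

Definition content s : R := Num.sqrt (gram s).

Lemma content_ge0 s : 0 <= content s.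
Proof. exact: sqrtr_ge0. Qed.

Lemma perm_content s t : perm_eq s t -> content s = content t.
Proof. by rewrite /content => /perm_gram->. Qed.

Lemma content_cons x s : content (x :: s) = norm (resid s x) * content s.
Proof. by rewrite /content gram_cons sqrtrM // ip_ge0. Qed.

(** For [r = resid s x], the projection property gives [|r|^2 = ip r x <= |r| |x|]. *)
Lemma ip_norm_resid_le s x : norm (resid s x) <= norm x.
Proof.
have [r0|r0] := eqVneq (norm (resid s x)) 0; first by rewrite r0 ip_norm_ge0.
have r_gt0 : 0 < norm (resid s x) by rewrite lt_def r0 ip_norm_ge0.
rewrite -(ler_pM2l r_gt0) -expr2 ip_norm_sqr -resid_adj resid_id.
exact: Cauchy_Schwarz.
Qed.

(** * Families as sequences, with omitted or substituted vectors *)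

Section Families.
Context {I : finType}.
Implicit Types (v : I -> H) (i j : I).

(** With sequences, omitting indices is filtering and [content_cons] applies directly; the order of
    the entries is immaterial by [perm_content]. *)
Definition family v := [seq v k | k <- enum I].
Definition rest v i := [seq v k | k <- enum I & k != i].
Definition rest2 v i j := [seq v k | k <- enum I & (k != i) && (k != j)].
Definition subst v i u := fun j => if j == i then u else v j.

Lemma perm_family v i : perm_eq (family v) (v i :: rest v i).
Proof.
rewrite -[_ :: _]/(map v (i :: _)); apply/perm_map.
by rewrite -rem_filter ?enum_uniq // perm_to_rem // mem_enum.
Qed.

Lemma perm_rest v i j : j != i -> perm_eq (rest v i) (v j :: rest2 v i j).
Proof.
move=> ji; rewrite -[_ :: _]/(map v (j :: _)); apply/perm_map.
rewrite [X in _ :: X](_ : _ = filter (predC1 j) [seq k <- enum I | k != i]);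
  last by rewrite -filter_predI; apply: eq_filter => k /=; rewrite andbC.
rewrite -rem_filter; last exact/filter_uniq/enum_uniq.
by apply: perm_to_rem; rewrite mem_filter ji mem_enum.
Qed.

Lemma rest2C v i j : rest2 v i j = rest2 v j i.
Proof. by congr map; apply: eq_filter => k; rewrite andbC. Qed.

Lemma rest_subst v i u : rest (subst v i u) i = rest v i.
Proof. by apply/eq_in_map => k; rewrite mem_filter /subst; case: eqP. Qed.

Lemma rest2_subst v i j u : rest2 (subst v i u) i j = rest2 v i j.
Proof. by apply/eq_in_map => k; rewrite mem_filter /subst; case: eqP. Qed.

Lemma mem_rest v i j : j != i -> v j \in rest v i.
Proof. by move=> ji; rewrite map_f // mem_filter ji mem_enum. Qed.

Lemma perm_family_subst v i u : perm_eq (family (subst v i u)) (u :: rest v i).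
Proof.
by have := perm_family (subst v i u) i; rewrite rest_subst {2}/subst eqxx.
Qed.

End Families.

Lemma size_family n (v : 'I_n -> H) : size (family v) = n.
Proof. by rewrite /family size_map fintype.size_enum_ord. Qed.

Lemma nth_family n (v : 'I_n -> H) (i : 'I_n) : (family v)`_i = v i.
Proof.
rewrite /family (nth_map i); first by rewrite fintype.nth_ord_enum.
by rewrite fintype.size_enum_ord.
Qed.

Lemma content_family n (v : 'I_n -> H) : content (family v) = abs_content ip v.
Proof.
rewrite /content (gram_size (size_family v)); congr (Num.sqrt (\det _)).
by apply/matrixP => i j; rewrite !mxE !nth_family.
Qed.

(** Filtering out [i] and enumerating through [lift i] list the same indices up to order. *)
Lemma content_rest n (v : 'I_n.+1 -> H) i :
  content (rest v i) = abs_content ip (v \o lift i).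
Proof.
rewrite -content_family; apply: perm_content.
rewrite /family (map_comp v); apply: perm_map.
apply: uniq_perm => [||k].
- exact/filter_uniq/enum_uniq.
- by rewrite map_inj_uniq ?enum_uniq //; apply: lift_inj.
rewrite mem_filter mem_enum andbT.
apply/idP/mapP => [|[j _ ->]]; last by rewrite eq_sym neq_lift.
case: (unliftP i k) => [j ->|->]; last by rewrite eqxx.
by move=> _; exists j; rewrite ?mem_enum.
Qed.

Lemma family_span n (v : 'I_n -> H) u : exists (c : 'I_n -> R) q,
  u = \sum_i c i *: v i + q /\ forall i, ip q (v i) = 0.
Proof.
have [c uE] := resid_span (family v) u.
exists (fun i => c i), (resid (family v) u); split; last first.
  by move=> i; apply: resid_orth; rewrite map_f ?mem_enum.
rewrite {1}uE addrC; congr (_ + _).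
rewrite size_family; apply: eq_bigr => i _; congr (_ *: _).
exact: nth_family.
Qed.

(** * Simplex inequalities for contents *)

Lemma content_simplex n (v : 'I_n.+1 -> H) u :
  norm u * content (family v) <=
  \sum_i content (family (subst v i u)) * norm (v i).
Proof.
set M := content (family v).
have M0 : 0 <= M := content_ge0 _.
have [c [q [uE qv]]] := family_span v u.
have normq x : ip q x = 0 -> norm (x + q) ^+ 2 = norm x ^+ 2 + norm q ^+ 2.
  by move=> qx; rewrite !ip_norm_sqr ipDl !ipDr (ipC x q) qx addr0 add0r.
have normZ a x : norm (a *: x) ^+ 2 = a ^+ 2 * norm x ^+ 2.
  by rewrite !ip_norm_sqr ipZl ipZr mulrA.
have term i : norm (c i *: v i + q) * M <=
    content (family (subst v i u)) * norm (v i).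
  rewrite (perm_content (perm_family_subst v i u)) content_cons.
  rewrite /M (perm_content (perm_family v i)) content_cons.
  rewrite mulrA [leRHS]mulrAC; apply: ler_wpM2r; first exact: content_ge0.
  set r := resid _ (v i).
  have qw w : w \in rest v i -> ip q w = 0 by case/mapP => k _ ->.
  (* Modulo the other vectors only the [i]-th term of [u] survives, while [q], orthogonal to all of
     them, is unchanged. *)
  have -> : resid (rest v i) u = c i *: r + q.
    rewrite uE residD resid_sum (resid_fix qw); congr (_ + _).
    rewrite (bigD1 i) //= big1 ?addr0 ?residZ // => k ki.
    by rewrite residZ resid_mem ?scaler0 // mem_rest.
  have qr : ip q r = 0 by rewrite -resid_adj (resid_fix qw).
  (* After squaring, Pythagoras cancels the terms in [c i], leaving
     [|q|^2 |r|^2 <= |q|^2 |v i|^2]. *)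
  rewrite -(@ler_pXn2r _ 2) ?nnegrE ?mulr_ge0 ?ip_norm_ge0 //.
  rewrite !exprMn !normq ?ipZr ?qr ?qv ?mulr0 // !normZ.
  have : norm r ^+ 2 <= norm (v i) ^+ 2.
    by rewrite ler_pXn2r ?nnegrE ?ip_norm_ge0 // ip_norm_resid_le.
  by move/(ler_wpM2l (sqr_ge0 (norm q))); lra.
apply: le_trans (ler_sum _ (fun i _ => term i)); rewrite -mulr_suml.
(* The vectors [c i *: v i + q] add up to [u + n *: q], no shorter than [u]. *)
apply: ler_wpM2r => //; apply: le_trans (ler_ip_norm_sum _).
rewrite -(@ler_pXn2r _ 2) ?nnegrE ?ip_norm_ge0 //.
have qs : ip q (\sum_i c i *: v i) = 0.
  by rewrite ipC ip_suml big1 // => i _; rewrite ipZl ipC qv mulr0.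
rewrite big_split /= sumr_const card_ord uE normq // -[q *+ _]scaler_nat.
rewrite [norm (_ + _) ^+ 2]ip_norm_sqr ipDl !ipDr !ipZl !ipZr.
rewrite (ipC (\sum_i _) q) qs !mulr0 addr0 add0r.
rewrite -!ip_norm_sqr lerD2l mulrA ler_peMl ?sqr_ge0 //.
by rewrite -natrM ler1n.
Qed.

(** This is [content_simplex] for the residuals modulo [W] of [x], [y] and [u], multiplied by
    [content W ^+ 2]. *)
Lemma content_triangle W x y u :
  content [:: x, y & W] * content (u :: W) <=
  content [:: u, y & W] * content (x :: W) +
  content [:: x, u & W] * content (y :: W).
Proof.
pose v (i : 'I_2) := if i == 0 then resid W x else resid W y.
have fam (f : 'I_2 -> H) : family f = [:: f ord0; f (lift ord0 ord0)].
  by rewrite /family !enum_ordSl /= enum_ord0.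
(* By computation, [resid (b :: W) a] is the residual of [resid W a] modulo [resid W b]. *)
have two (a b : H) : content [:: a, b & W] =
    content [:: resid W a; resid W b] * content W.
  have c0 : content [::] = 1 by rewrite /content /gram det_mx00 sqrtr1.
  by rewrite !content_cons /= c0 mulr1 mulrA.
have := content_simplex v (resid W u); rewrite !big_ord_recl big_ord0 addr0.
rewrite !fam /subst /v /=; rewrite !two !(content_cons _ W).
move/(ler_wpM2r (sqr_ge0 (content W))) => h.
rewrite -subr_ge0 in h; rewrite -subr_ge0; move: h; congr (0 <= _); ring.
Qed.


(** * Permutation invariance and the polar sine *)

Lemma perm_eq_family_comp n (s : 'S_n) (v : 'I_n -> H) :
  perm_eq (family (v \o s)) (family v).
Proof.
rewrite /family (map_comp v s); apply: perm_map.
apply: uniq_perm => [||k].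
- by rewrite map_inj_uniq ?enum_uniq //; apply: perm_inj.
- exact: enum_uniq.
- rewrite mem_enum; apply/mapP.
  by exists ((s^-1)%g k); rewrite ?mem_enum // permKV.
Qed.

(** Adjoining [v (s j)] to both sides restores the full families. *)
Lemma perm_eq_rest_comp n (s : 'S_n) (v : 'I_n -> H) j :
  perm_eq (rest (v \o s) j) (rest v (s j)).
Proof.
rewrite -(perm_cons (v (s j))) -(permPr (perm_family v (s j))).
by rewrite -(permPl (perm_family (v \o s) j)) perm_eq_family_comp.
Qed.

Lemma abs_content_comp n (s : 'S_n) (v : 'I_n -> H) :
  abs_content ip (v \o s) = abs_content ip v.
Proof. by rewrite -!content_family; apply/perm_content/perm_eq_family_comp. Qed.

Lemma abs_psin0_simplex d (v : 'I_d.+1 -> H) u :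
  (forall i, v i != 0) -> u != 0 ->
  abs_psin0 ip v <= \sum_i abs_psin0 ip (subst v i u).
Proof.
move=> v0 u0; rewrite /abs_psin0.
have v_gt0 i : 0 < norm (v i) by rewrite ip_norm_gt0.
have u_gt0 : 0 < norm u by rewrite ip_norm_gt0.
set D := \prod_j norm (v j).
have D_gt0 : 0 < D by apply: prodr_gt0.
rewrite gt_eqF // ler_pdivrMr // -(ler_pM2l u_gt0) -(content_family v).
apply: le_trans (content_simplex v u) _; rewrite mulr_suml mulr_sumr.
apply: ler_sum => i _; rewrite -content_family.
set Di := \prod_j _.
(* The substitution trades the factor [norm (v i)] for [norm u], so [content_simplex] divided by
   [norm u * D] has the required terms. *)
have DiE : Di * norm (v i) = norm u * D.
  rewrite /Di /D (bigD1 i) //= [in RHS](bigD1 i) //= {1}/subst eqxx.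
  rewrite (eq_bigr (fun j => norm (v j))) => [|j /negPf ji]; last by rewrite /subst ji.
  by rewrite -mulrA; congr (_ * _); rewrite mulrC.
have Di_gt0 : 0 < Di by rewrite -(pmulr_lgt0 _ (v_gt0 i)) DiE mulr_gt0.
by rewrite gt_eqF // mulrCA -DiE mulrA divfK ?gt_eqF.
Qed.

Lemma semimetric_psin d : semimetric [set~ (0 : H)] (abs_psin0 ip (d := d)).
Proof.
split=> [v _|s v _|v u v0 /eqP u0].
- rewrite /abs_psin0; case: ifP => // _.
  by rewrite divr_ge0 ?sqrtr_ge0 ?prodr_ge0 // => i _; exact: ip_norm_ge0.
- rewrite /abs_psin0 abs_content_comp.
  suff -> : \prod_j norm ((v \o s) j) = \prod_j norm (v j) by [].
  by rewrite [RHS](reindex_inj (@perm_inj _ s)).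
- by apply: abs_psin0_simplex => // i; apply/eqP/v0.
Qed.

(** * The root of the hypersine *)

Lemma powR_inv_exprn d (x : R) : (0 < d)%N -> 0 <= x -> (x `^ d%:R^-1) ^+ d = x.
Proof.
move=> d0 x0; rewrite -powR_mulrn ?powR_ge0 // -powRrM mulVf ?powRr1 //.
by rewrite pnatr_eq0 -lt0n.
Qed.

Lemma abs_gsin0_ge0 d (v : 'I_d.+1 -> H) : 0 <= abs_gsin0 ip v.
Proof.
by rewrite /abs_gsin0; case: ifP => // _; rewrite divr_ge0 ?sqrtr_ge0 ?powR_ge0.
Qed.

(** An instance of [content_triangle] with [W := rest2 v i j], up to reordering. *)
Lemma content_subst_triangle n (v : 'I_n -> H) u i j : j != i ->
  content (family v) * content (u :: rest2 v i j) <=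
  content (u :: rest v i) * content (rest v j) +
  content (u :: rest v j) * content (rest v i).
Proof.
move=> ji; have := content_triangle (rest2 v i j) (v i) (v j) u.
have ri : perm_eq (rest v i) (v j :: rest2 v i j) by exact: perm_rest.
have rj : perm_eq (rest v j) (v i :: rest2 v i j).
  by rewrite rest2C; apply: perm_rest; rewrite eq_sym.
have -> : content [:: v i, v j & rest2 v i j] = content (family v).
  by apply/esym/perm_content/(perm_trans (perm_family v i)); rewrite perm_cons.
have -> : content [:: v i, u & rest2 v i j] = content (u :: rest v j).
  apply/esym/perm_content; apply: (@perm_trans _ [:: u, v i & rest2 v i j]).
    by rewrite perm_cons.
  exact/permPl/(perm_catCA [:: u] [:: v i]).
have -> : content [:: u, v j & rest2 v i j] = content (u :: rest v i).
  by apply/esym/perm_content; rewrite perm_cons.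
by rewrite (perm_content ri) (perm_content rj).
Qed.

Lemma content_rest_subst n (v : 'I_n -> H) u i j : j != i ->
  content (rest (subst v i u) j) = content (u :: rest2 v i j).
Proof.
move=> ji; apply: perm_content.
have ij : i != j by rewrite eq_sym.
have := perm_rest (subst v i u) ij.
by rewrite rest2C rest2_subst {2}/subst eqxx.
Qed.

(** Adjoining [v j] to a degenerate family keeps it degenerate. This settles the terms whose
    denominator vanishes. *)
Lemma content_rest2_eq0 n (v : 'I_n -> H) u i j : j != i ->
  content (u :: rest2 v i j) = 0 -> content (u :: rest v i) = 0.
Proof.
move=> ji c0.
rewrite (@perm_content _ [:: v j, u & rest2 v i j]).
  by rewrite content_cons c0 mulr0.
apply: (@perm_trans _ [:: u, v j & rest2 v i j]); first by rewrite perm_cons perm_rest.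
exact/permPl/(perm_catCA [:: u] [:: v j]).
Qed.

Lemma abs_gsin0_simplex d (v : 'I_d.+1 -> H) u : (0 < d)%N ->
  (forall i, v i != 0) -> u != 0 ->
  abs_gsin0 ip v <= \sum_i abs_gsin0 ip (subst v i u).
Proof.
move=> d0 v0 u0.
pose M := content (family v).
pose m i := content (rest v i).
pose M' i := content (u :: rest v i).
pose n i j := content (u :: rest2 v i j).
have sum_ge0 : 0 <= \sum_i abs_gsin0 ip (subst v i u).
  by apply: sumr_ge0 => i _; apply: abs_gsin0_ge0.
have [M0|M0] := eqVneq M 0.
  by rewrite /abs_gsin0 -(content_family v) -/M M0 mul0r if_same.
have M_gt0 : 0 < M by rewrite lt_def M0 content_ge0.
have m_gt0 i : 0 < m i.
  rewrite lt_def content_ge0 andbT; apply: contraNneq M0 => mi0.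
  by rewrite /M (perm_content (perm_family v i)) content_cons -/(m i) mi0 mulr0.
have M'_ge0 i : 0 <= M' i by apply: content_ge0.
have n_ge0 i j : 0 <= n i j by apply: content_ge0.
pose S := \sum_i M' i / m i.
have S_ge i : M' i / m i <= S.
  rewrite /S (bigD1 i) //= lerDl sumr_ge0 // => j _.
  by rewrite divr_ge0 // ltW.
have S_gt0 : 0 < S.
  rewrite lt_def; apply/andP; split; last first.
    by apply: sumr_ge0 => j _; rewrite divr_ge0 // ltW.
  (* If [S] were 0, every [M' i] would vanish and [content_simplex] would give [norm u * M <= 0]. *)
  apply: contraTneq (content_simplex v u) => S0.
  rewrite big1 => [|i _]; last first.
    rewrite (perm_content (perm_family_subst v i u)) -/(M' i).
    suff -> : M' i = 0 by rewrite mul0r.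
    apply/eqP; rewrite eq_le M'_ge0 andbT.
    by have := S_ge i; rewrite S0 ler_pdivrMr // mul0r.
  by rewrite -ltNge mulr_gt0 // ip_norm_gt0.
pose P := (\prod_j m j) `^ d%:R^-1.
have Pm_gt0 : 0 < \prod_j m j by apply: prodr_gt0.
have P_gt0 : 0 < P by apply: powR_gt0.
have Pd : P ^+ d = \prod_j m j by apply: powR_inv_exprn => //; apply: ltW.
have key i j : j != i -> n i j <= m i * m j * S / M.
  move=> ji; rewrite ler_pdivlMr // mulrC.
  apply: le_trans (content_subst_triangle v u ji) _.
  have -> : content (u :: rest v i) * content (rest v j) +
      content (u :: rest v j) * content (rest v i) =
      m i * m j * (M' i / m i + M' j / m j).
    by rewrite -/(M' i) -/(M' j) -/(m i) -/(m j); field; rewrite !gt_eqF.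
  (* As [i] and [j] are distinct, both quotients are separate terms of [S], and the remaining ones
     are nonnegative. *)
  rewrite ler_pM2l ?mulr_gt0 // /S (bigD1 i) //= lerD2l (bigD1 j) //= lerDl.
  by apply: sumr_ge0 => k _; rewrite divr_ge0 // ltW.
have gE : abs_gsin0 ip v = M / P.
  rewrite /abs_gsin0 -(content_family v) -/M.
  under eq_bigr do rewrite -content_rest.
  by rewrite -/P gt_eqF.
(* Multiplying by [S] and expanding it on the left only makes both sides sums over [i], compared
   term by term. *)
rewrite gE -(ler_pM2r S_gt0) [X in X <= _]mulr_sumr mulr_suml.
apply: ler_sum => i _.
rewrite /abs_gsin0 -content_family (perm_content (perm_family_subst v i u)) -/(M' i).
under eq_bigr do rewrite -content_rest.
rewrite (bigD1 i) //= rest_subst -/(m i).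
under eq_bigr => j ji do rewrite content_rest_subst // -/(n i j).
set Q := m i * _; set D := Q `^ _.
have Q_ge0 : 0 <= Q.
  by rewrite mulr_ge0 ?(ltW (m_gt0 i)) // prodr_ge0 // => j _; apply: n_ge0.
have Dd : D ^+ d = Q by apply: powR_inv_exprn.
have D_ge0 : 0 <= D by apply: powR_ge0.
(* When [D] is 0 the right-hand term is 0 by convention; then some [n i j] is 0, which forces
   [M' i = 0] and kills the left-hand term too. *)
case: ifPn => [/eqP D0|D0].
  have : Q = 0 by rewrite -Dd D0 expr0n -[d == 0%N]negbK -lt0n d0.
  move/eqP; rewrite mulf_eq0 gt_eqF //= => /prodf_eq0[j ji /eqP nij].
  by rewrite /M' (content_rest2_eq0 ji nij) !mul0r mulr0.
have D_gt0 : 0 < D by rewrite lt_def D0.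
have D_le : D <= m i * P * S / M.
  have B_gt0 : 0 < m i * P * S / M by rewrite divr_gt0 ?mulr_gt0.
  rewrite -(@ler_pXn2r _ d) ?nnegrE ?(ltW B_gt0) // Dd.
  (* There are exactly [d] indices [j != i], so the constant [m i * S / M] appears to the power [d],
     and the leading [m i] completes the product [P ^+ d]. *)
  have -> : (m i * P * S / M) ^+ d = m i * \prod_(j < d.+1 | j != i) (m i * m j * S / M).
    rewrite (eq_bigr (fun j => m i * S / M * m j)) => [|j _]; last by field; rewrite gt_eqF.
    rewrite big_split /= prodr_const cardC1 card_ord /= mulrCA.
    rewrite -(bigD1 i (P := predT) (F := m)) //= -Pd -exprMn; congr (_ ^+ _).
    by field; rewrite gt_eqF.
  rewrite ler_pM2l //; apply: ler_prod => j ji; rewrite n_ge0; exact: key.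
have -> : M / P * (M' i / m i) = M' i * (M / (m i * P)).
  by field; rewrite !gt_eqF.
rewrite -mulrA; apply: ler_wpM2l => //.
rewrite [leRHS]mulrC ler_pdivlMr // mulrAC ler_pdivrMr ?mulr_gt0 //.
by move: D_le; rewrite ler_pdivlMr // (mulrC M) (mulrC S).
Qed.

Lemma semimetric_gsin d : (0 < d)%N ->
  semimetric [set~ (0 : H)] (abs_gsin0 ip (d := d)).
Proof.
move=> d0; split=> [v _|s v _|v u v0 /eqP u0]; first exact: abs_gsin0_ge0.
  rewrite /abs_gsin0 abs_content_comp.
  (* A permutation of the family merely permutes the factors of the denominator: omitting [j] after
     [s] amounts to omitting [s j]. *)
  suff -> : \prod_j abs_content ip ((v \o s) \o lift j) =
      \prod_j abs_content ip (v \o lift j) by [].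
  rewrite [RHS](reindex_inj (@perm_inj _ s)); apply: eq_bigr => j _.
  by rewrite -!content_rest; apply/perm_content/perm_eq_rest_comp.
by apply: abs_gsin0_simplex => // i; apply/eqP/v0.
Qed.

End PreHilbertTheory.

Theorem theorem1p1 (R : realType) (H : lmodType R) (ip : {dot H for @idfun R})
    (d : nat) (hd : (1 <= d)%N) (hdim : dim_ge H d.+1) :
  semimetric [set~ (0 : H)] (abs_psin0 ip (d := d)) /\
  semimetric [set~ (0 : H)] (abs_gsin0 ip (d := d)).
Proof. by split; [exact: semimetric_psin|exact: semimetric_gsin]. Qed.
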